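(* For each integer $k\ge 1$, let $G_k$ be a directed graph obtained from $k$ vertex-disjoint copies of a $2$-regular directed complete graph on $5$ vertices by adding one extra vertex $x$ and exactly one edge from each of the $k$ copies to $x$ (so that $\deg^{in}(x)=k$). Let $dyn(G_k)$ denote the smallest size of a strict majority dynamic monopoly of $G_k$. Then $dyn(G_k)=2k$ for every $k$, and $$\lim_{k\to\infty}\frac{dyn(G_k)}{|G_k|}=\frac{2}{5}.$$
   Context: A $2$-regular directed complete graph on $5$ vertices is an orientation of the edges of the complete graph $K_5$ in which every vertex has in-degree $2$. $|G|$ denotes the number of vertices of $G$, and $\deg^{in}(v)$ the in-degree of $v$. Given a directed graph $G$ and a threshold assignment $\tau:V(G)\to\mathbb{N}$, a subset $M\subseteq V(G)$ is a dynamic monopoly for $(G,\tau)$ if $V(G)$ can be partitioned as $D_0\cup D_1\cup\dots\cup D_t$ with $D_0=M$ such that for every $i\ge 1$ and every $v\in D_i$, the number of edges from $D_0\cup\dots\cup D_{i-1}$ to $v$ is at least $\tau(v)$. A strict majority dynamic monopoly of $G$ is a dynamic monopoly for $(G,\tau)$ with $\tau(v)=\lceil (\deg^{in}(v)+1)/2\rceil$ for every vertex $v$. *)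

(* Defs.v *)
(* MathComp, with MathComp-Analysis for the limit. *)
From HB Require Import structures.
From mathcomp Require Import all_boot all_order all_algebra.
From mathcomp Require Import all_classical all_reals all_analysis.

Set Implicit Arguments.
Unset Strict Implicit.
Unset Printing Implicit Defensive.

Import Order.TTheory GRing.Theory Num.Theory.
Import numFieldNormedType.Exports.

Local Open Scope nat_scope.

Record digraph := Digraph { vertex :> finType; edge : rel vertex }.

Definition indeg (G : digraph) (v : G) : nat := #|[set u : G | edge u v]|.

Definition digraph_iso (G H : digraph) : Prop :=
  exists2 f : G -> H, bijective f & forall u v : G, edge (f u) (f v) = edge u v.

(* An orientation of the complete graph on the vertices of [H]: no loops, and
   exactly one of the arcs uv, vu for each pair of distinct vertices. *)
Definition complete_orientation (H : digraph) : Prop :=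
  (forall u : H, ~~ edge u u) /\
  (forall u v : H, u != v -> edge u v (+) edge v u).

Definition regular_complete (d n : nat) (H : digraph) : Prop :=
  [/\ #|{: H}| = n, complete_orientation H & forall v : H, indeg v = d].

(* [Some (i, a)] is the vertex a of the i-th copy of [H], [None] is the extra
   vertex x, and [c i] is the tail of the unique arc from the i-th copy to x. *)
Definition glue_edge (k : nat) (H : digraph) (c : 'I_k -> H) :
    rel (option ('I_k * H)) := fun p q =>
  match p, q with
  | Some (i, a), Some (j, b) => (i == j) && edge a b
  | Some (i, a), None => a == c i
  | None, _ => false
  end.

Definition glue (k : nat) (H : digraph) (c : 'I_k -> H) : digraph :=
  Digraph (@glue_edge k H c).

Definition is_Gk (k : nat) (G : digraph) : Prop :=
  exists (H : digraph) (c : 'I_k -> H),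
    regular_complete 2 5 H /\ digraph_iso G (glue c).

(* The parts D_i may be empty. *)
Definition dynamic_monopoly (G : digraph) (tau : G -> nat) (M : {set G}) : Prop :=
  exists (t : nat) (D : 'I_t.+1 -> {set G}),
    [/\ D ord0 = M,
        \bigcup_(i < t.+1) D i = [set: G],
        forall i j : 'I_t.+1, i != j -> [disjoint D i & D j]
      & forall (i : 'I_t.+1) (v : G), 1 <= i -> v \in D i ->
          tau v <= #|[set u in \bigcup_(j < t.+1 | j < i) D j | edge u v]|].

(* [uphalf n] is the ceiling of n / 2. *)
Definition strict_majority (G : digraph) (v : G) : nat := uphalf (indeg v + 1).

Definition strict_majority_dynamic_monopoly (G : digraph) (M : {set G}) : Prop :=
  dynamic_monopoly (@strict_majority G) M.

(* The default [set: G] is always admissible, see [dyn_min]. *)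
Definition dyn (G : digraph) : nat :=
  #|[arg min_(M < [set: G] | `[< strict_majority_dynamic_monopoly M >]) #|M|]|.

Lemma dynamic_monopolyT (G : digraph) (tau : G -> nat) :
  dynamic_monopoly tau [set: G].
Proof.
exists 0, (fun=> [set: G]); split=> //.
- by rewrite big_ord1.
- by move=> i j; rewrite !ord1.
- by move=> i v; rewrite ord1.
Qed.

Lemma dyn_min (G : digraph) :
  (exists2 M : {set G}, strict_majority_dynamic_monopoly M & #|M| = dyn G) /\
  (forall M : {set G}, strict_majority_dynamic_monopoly M -> dyn G <= #|M|).
Proof.
rewrite /dyn; case: arg_minnP => [|M /asboolP MG Mmin].
  exact/asboolP/dynamic_monopolyT.
by split=> [|N NG]; [exists M | apply: Mmin; apply/asboolP].
Qed.

(* Main.v *)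
(** A dynamic monopoly is the zero set of a rank function [r] such that each
    vertex of positive rank has enough in-neighbours of smaller rank.  In this
    form dynamic monopolies restrict to the copies of [H] in [glue c], which
    receive no arc from outside, and conversely those of the copies glue
    together, the extra vertex being activated last.  Hence
    [dyn (glue c) = k * dyn H].
    In a 2-regular tournament on 5 vertices all thresholds are 2: a vertex of
    least positive rank needs two in-neighbours in the monopoly, and the
    complement of a transitive triangle is a monopoly of size 2. *)
Require Import Defs.
From mathcomp Require Import all_boot all_order all_algebra.
From mathcomp Require Import all_classical all_reals all_analysis.
From mathcomp Require Import zify ring lra.

Import Order.TTheory GRing.Theory Num.Theory.
Import numFieldNormedType.Exports.

(** * Rank functions in place of ordered partitions *)

Definition activation_rank (G : digraph) (tau : G -> nat) (M : {set G})
    (r : G -> nat) : Prop :=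
  (forall v, (v \in M) = (r v == 0)) /\
  (forall v, 0 < r v -> tau v <= #|[set u | (r u < r v) && edge u v]|).

Lemma dynamic_monopolyP {G : digraph} {tau : G -> nat} {M : {set G}} :
  dynamic_monopoly tau M <-> exists r, activation_rank G tau M r.
Proof.
split=> [[t [D [D0 DT Ddis Dtau]]]|[r [r0 rtau]]].
  have /fin_all_exists[i Di] (v : G) : exists i : 'I_t.+1, v \in D i.
    have : v \in \bigcup_(i < t.+1) D i by rewrite DT inE.
    by case/bigcupP=> i _ vi; exists i.
  (* Disjointness of the parts makes the chosen index unique, so it can serve as a rank. *)
  have DiE v j : v \in D j -> j = i v.
    move=> vj; apply/eqP; apply: contraT => /Ddis.
    by move=> /pred0P/(_ v) /=; rewrite vj Di.
  exists (fun v => i v); split=> [v|v iv].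
    rewrite -D0; apply/idP/eqP => [/DiE <- //|iv0].
    by have -> : ord0 = i v by apply: val_inj.
  apply: leq_trans (Dtau (i v) v iv (Di v)) (subset_leq_card _).
  apply/fintype.subsetP=> u; rewrite !inE => /andP[/bigcupP[j ji uj] ->].
  by rewrite -(DiE _ _ uj) ji.
(* Conversely the parts are the level sets of [r]; ranks may skip values, which gives empty
   parts. *)
pose t := \max_v r v.
have rt v : r v < t.+1 by rewrite ltnS (leq_bigmax (F := r)).
exists t, (fun i : 'I_t.+1 => [set v | r v == i]); split.
- by apply/setP=> v; rewrite inE r0.
- apply/setP=> v; rewrite [in RHS]inE; apply/bigcupP.
  by exists (Ordinal (rt v)); rewrite ?inE.
- move=> i j ij; apply/pred0P=> v /=; rewrite !inE; apply/negP.
  by case/andP=> /eqP-> /eqP/val_inj /eqP; apply/negP.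
- move=> i v i0; rewrite inE => /eqP vi.
  apply: leq_trans (rtau v _) (subset_leq_card _); first by rewrite vi.
  apply/fintype.subsetP=> u; rewrite !inE => /andP[uv ->]; rewrite andbT.
  by apply/bigcupP; exists (Ordinal (rt u)); rewrite ?inE //= -vi.
Qed.

(** * Invariance under isomorphism *)

Lemma card_preimset_bij {S T : finType} {f : S -> T} (P : pred T) :
  bijective f -> #|[set u | P (f u)]| = #|[set w | P w]|.
Proof.
move=> fbij; rewrite -(card_imset _ (bij_inj fbij)); apply: eq_card => w.
case: fbij => g fK gK; rewrite inE; apply/imsetP/idP => [[u]|Pw].
  by rewrite inE => Pfu ->.
by exists (g w); rewrite ?inE gK.
Qed.

Lemma digraph_iso_sym {G H : digraph} : digraph_iso G H -> digraph_iso H G.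
Proof.
case=> f [g fK gK] fE; exists g; first by exists f.
by move=> u v; rewrite -fE !gK.
Qed.

(** A minimum monopoly of [H] and its rank function pull back along the isomorphism. *)
Lemma dyn_iso_le {G H : digraph} : digraph_iso G H -> dyn G <= dyn H.
Proof.
case=> f fbij fE; have [[M /dynamic_monopolyP[r [r0 rtau]] <-] _] := dyn_min H.
rewrite -[M](_ : [set w | w \in M] = M); last by apply/setP=> w; rewrite inE.
rewrite -(card_preimset_bij _ fbij).
apply: (proj2 (dyn_min G)); apply/dynamic_monopolyP.
exists (r \o f); split=> v /=; first by rewrite inE r0.
move=> /rtau; rewrite /strict_majority /indeg.
rewrite -(card_preimset_bij (fun w : H => edge w (f v)) fbij).
rewrite -(card_preimset_bij (fun w : H => (r w < r (f v)) && edge w (f v)) fbij).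
have EE (P : pred G) : [set u | P u && edge (f u) (f v)] = [set u | P u && edge u v].
  by apply/setP=> u; rewrite !inE fE.
by rewrite (EE predT) (EE (fun u => r (f u) < r (f v))).
Qed.

Lemma dyn_iso {G H : digraph} : digraph_iso G H -> dyn G = dyn H.
Proof.
by move=> GH; apply/eqP; rewrite eqn_leq !dyn_iso_le //; apply: digraph_iso_sym.
Qed.

(** * Counting and monopolies in the glued graph *)

(** No arc enters a copy from another copy or from the extra vertex. The predicate [P] is arbitrary
    so that the lemma covers both in-degrees and in-neighbours of smaller rank. *)
Lemma card_glue_copy {k : nat} {H : digraph} (c : 'I_k -> H) (i : 'I_k) (a : H)
    (P : pred (Defs.glue c)) :
  #|[set u : Defs.glue c | P u && edge u (Some (i, a))]| =
  #|[set b : H | P (Some (i, b)) && edge b a]|.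
Proof.
rewrite -[RHS](card_imset _ (f := fun b : H => Some (i, b) : Defs.glue c)); last first.
  by move=> b1 b2 [].
apply: eq_card => -[[j b]|]; rewrite !inE /=; last first.
  by rewrite andbF; apply/esym/negbTE/imsetP => -[].
apply/and3P/imsetP => [[Pb /eqP ji ba]|[b']].
  by exists b; rewrite ?inE -ji ?Pb.
by rewrite inE => /andP[Pb ba] [-> ->]; rewrite eqxx.
Qed.

Lemma indeg_glue_copy {k : nat} {H : digraph} (c : 'I_k -> H) (i : 'I_k) (a : H) :
  indeg (G := Defs.glue c) (Some (i, a)) = indeg a.
Proof. exact: (card_glue_copy c i a predT). Qed.

Lemma indeg_glue_extra {k : nat} {H : digraph} (c : 'I_k -> H) :
  indeg (G := Defs.glue c) None = k.
Proof.
rewrite -[RHS]card_ord /indeg.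
rewrite -(card_codom (f := fun i : 'I_k => Some (i, c i))); last by move=> ? ? [].
apply: eq_card => -[[i a]|]; rewrite inE /=; last by apply/esym/negbTE/codomP => -[].
by apply/eqP/codomP => [->|[j []] -> -> //]; exists i.
Qed.

Lemma card_glue_set {k : nat} {H : digraph} (c : 'I_k -> H) (M : {set Defs.glue c}) :
  #|M| = \sum_(i < k) #|[set a | Some (i, a) \in M]| + (None \in M).
Proof.
rewrite -sum1_card big_mkcond (bigD1 None) //= addnC; congr (_ + _).
under [RHS]eq_bigr do rewrite -sum1dep_card big_mkcond.
rewrite pair_big /= (reindex_omap Some id) /=; last by case=> [[]|].
by apply: eq_big => [[i a]|[i a] _] //=; rewrite ?eqxx.
Qed.

Lemma dyn_glue {k : nat} {H : digraph} (c : 'I_k -> H) :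
  1 <= k -> dyn (Defs.glue c) = k * dyn H.
Proof.
move=> k0; apply/eqP; rewrite eqn_leq; apply/andP; split.
  have [[M /dynamic_monopolyP[r [r0 rtau]] <-] _] := dyn_min H.
  pose N : {set Defs.glue c} := [set u | if u is Some (_, a) then a \in M else false].
  suff NP : strict_majority_dynamic_monopoly (G := Defs.glue c) N.
    apply: leq_trans (proj2 (dyn_min (Defs.glue c)) _ NP) _.
    rewrite card_glue_set inE addn0 (eq_bigr (fun=> #|M|)).
      by rewrite sum_nat_const card_ord.
    by move=> i _; apply: eq_card => a; rewrite !inE.
  apply/dynamic_monopolyP.
  pose t := \max_v r v.
  have rt v : r v < t.+1 by rewrite ltnS (leq_bigmax (F := r)).
  (* The rank [t.+1] exceeds all ranks in the copies, so the extra vertex has all its [k]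
     in-neighbours available. *)
  exists (fun u : Defs.glue c => if u is Some (_, a) then r a else t.+1).
  split=> [[[i a]|]|[[i a] /rtau|_]]; rewrite ?inE ?r0 //.
    by rewrite /strict_majority indeg_glue_copy card_glue_copy.
  have -> : [set u : Defs.glue c | ((if u is Some (_, a) then r a else t.+1) < t.+1)
      && edge u None] = [set u : Defs.glue c | edge u None].
    by apply/setP=> -[[i a]|]; rewrite !inE ?rt //= andbF.
  (* The threshold [uphalf (k + 1)] is at most [k] exactly because [k] is positive. *)
  by rewrite -[#|_|]/(indeg (G := Defs.glue c) None) /strict_majority indeg_glue_extra; lia.
(* For the lower bound, the trace of a monopoly on each copy is a monopoly of [H]; the extra vertex
   can only add to the size. *)
have [[M /dynamic_monopolyP[r [r0 rtau]] <-] _] := dyn_min (Defs.glue c).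
rewrite card_glue_set; apply: leq_trans (leq_addr _ _).
rewrite -[k in k * _]card_ord -sum_nat_const; apply: leq_sum => i _.
apply: (proj2 (dyn_min H)); apply/dynamic_monopolyP.
exists (fun a => r (Some (i, a))); split=> a; first by rewrite inE r0.
by move/rtau; rewrite /strict_majority indeg_glue_copy card_glue_copy.
Qed.

(** * Regular tournaments on 5 vertices *)

(** All in-neighbours that activate a vertex of least positive rank lie in the monopoly. If no rank
    is positive, the monopoly is the whole vertex set, whence the bound on the order of [G]. *)
Lemma dyn_ge_threshold {G : digraph} (m : nat) :
  m <= #|{: G}| -> (forall v : G, m <= strict_majority v) -> m <= dyn G.
Proof.
move=> mG mtau; have [[M /dynamic_monopolyP[r [r0 rtau]] <-] _] := dyn_min G.
case: (pickP (fun v => 0 < r v)) => [v0 rv0|r_0]; last first.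
  rewrite (_ : M = [set: G]) ?cardsT //; apply/setP=> v.
  by rewrite r0 inE; case: (r v) (r_0 v).
case: (@arg_minnP _ v0 (fun v => 0 < r v) r rv0) => v rv vmin.
apply: leq_trans (mtau v) (leq_trans (rtau v rv) (subset_leq_card _)).
apply/fintype.subsetP=> u; rewrite inE r0 => /andP[uv _].
by apply: contraLR uv; rewrite -lt0n -leqNgt; apply: vmin.
Qed.

(** Out-neighbours and in-neighbours of [v] partition the other vertices. *)
Lemma outdeg_complete_orientation {H : digraph} (v : H) :
  complete_orientation H -> (#|[set u | edge v u]| + indeg v).+1 = #|{: H}|.
Proof.
case=> irr tot; rewrite -cardsT [RHS](cardsD1 v) inE add1n /indeg; congr _.+1.
rewrite -cardsUI -[RHS]addn0; congr (_ + _).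
  apply: eq_card => u; rewrite !inE andbT; case: eqVneq => [->|/tot].
    by rewrite (negbTE (irr v)).
  by case: (edge u v) (edge v u) => [] [].
apply/eqP; rewrite cards_eq0; apply/eqP/setP=> u; rewrite !inE.
case: (eqVneq u v) => [->|/tot]; first by rewrite (negbTE (irr v)).
by case: (edge u v) (edge v u) => [] [].
Qed.

(** Any vertex has 5 - 1 - 2 = 2 out-neighbours, and the arc between these two closes a transitive
    triangle. *)
Lemma transitive_triangle {H : digraph} :
  regular_complete 2 5 H ->
  exists x y z : H, [/\ edge x y, edge x z & edge y z].
Proof.
case=> H5 Hc Hd; have /card_gt0P[x _] : 0 < #|{: H}| by rewrite H5.
have := outdeg_complete_orientation x Hc; rewrite Hd H5 addn2 => -[].
move=> /eqP/cards2P[y [z [yz xE]]].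
have xy : edge x y by have := set21 y z; rewrite -xE inE.
have xz : edge x z by have := set22 y z; rewrite -xE inE.
have := proj2 Hc _ _ yz; case yzE: (edge y z) => /= zy.
  by exists x, y, z.
by exists x, z, y.
Qed.

Lemma dyn_regular_complete {H : digraph} : regular_complete 2 5 H -> dyn H = 2.
Proof.
move=> HH; have [H5 [irr tot] Hd] := HH.
have tau2 (v : H) : strict_majority v = 2 by rewrite /strict_majority Hd.
apply/eqP; rewrite eqn_leq dyn_ge_threshold ?H5 //; last by move=> v; rewrite tau2.
have [x [y [z [xy xz yz]]]] := transitive_triangle HH; rewrite andbT.
have neq (u v : H) : edge u v -> u != v by apply: contraTneq => ->; apply: irr.
have asym (u v : H) : edge u v -> edge v u = false.
  by move=> uv; have := tot _ _ (neq _ _ uv); rewrite uv; case: edge.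
have [[nxy nxz] nyz] := (neq _ _ xy, neq _ _ xz, neq _ _ yz).
pose M := ~: [set x; y; z].
have M2 : #|M| = 2.
  have := cardsC [set x; y; z]; rewrite -/M H5.
  by rewrite finset.setUC cardsU1 cards2 !inE !(eq_sym z) nxy negb_or nxz nyz /=; lia.
rewrite -M2; apply: (proj2 (dyn_min H)); apply/dynamic_monopolyP.
(* The triangle is activated in its transitive order. *)
pose r v := if v == x then 1 else if v == y then 2 else if v == z then 3 else 0.
have rx : r x = 1 by rewrite /r eqxx.
have ry : r y = 2 by rewrite /r eq_sym (negbTE nxy) eqxx.
have rz : r z = 3.
  by rewrite /r (eq_sym z) (negbTE nxz) (eq_sym z) (negbTE nyz) eqxx.
exists r; split=> v; first by rewrite !inE /r; do 3 case: eqP => //= _.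
(* The threshold 2 equals the in-degree, so it suffices that every in-neighbour has smaller rank: no
   arc of the triangle goes backwards. *)
move=> rv; rewrite tau2 -(Hd v); apply/subset_leq_card/fintype.subsetP => u.
rewrite !inE => uv; rewrite uv andbT; move: rv uv.
rewrite {1}/r; case: (eqVneq v x) => [->|_].
  move=> _; rewrite rx /r; case: (eqVneq u x) => [->|_]; first by rewrite (negbTE (irr x)).
  case: (eqVneq u y) => [->|_]; first by rewrite asym.
  by case: (eqVneq u z) => [->|_] //; rewrite asym.
case: (eqVneq v y) => [->|_].
  move=> _; rewrite ry /r; case: (eqVneq u x) => // _.
  case: (eqVneq u y) => [->|_]; first by rewrite (negbTE (irr y)).
  by case: (eqVneq u z) => [->|_] //; rewrite asym.
case: (eqVneq v z) => [->|//].
move=> _; rewrite rz /r; do 2 case: eqVneq => // _.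
by case: (eqVneq u z) => [->|_] //; rewrite (negbTE (irr z)).
Qed.

Lemma dyn_Gk {k : nat} {G : digraph} : 1 <= k -> is_Gk k G -> dyn G = 2 * k.
Proof.
move=> k0 [H [c [HH GH]]].
by rewrite (dyn_iso GH) dyn_glue // dyn_regular_complete // mulnC.
Qed.

Lemma card_Gk {k : nat} {G : digraph} : is_Gk k G -> #|{: G}| = (5 * k).+1.
Proof.
move=> [H [c [[H5 _ _] [f fbij _]]]].
by rewrite (bij_eq_card fbij) card_option card_prod card_ord H5 mulnC.
Qed.

(** * The limit *)

Local Open Scope classical_set_scope.
Local Open Scope ring_scope.

Lemma cvg_ratio (R : realType) :
  (fun k : nat => (2 * k)%:R / (5 * k).+1%:R : R) @ \oo --> (2 / 5 : R).
Proof.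
(* The ratio falls short of 2/5 by 2 / (5 (5k + 1)), which is below 1 / (k + 1). *)
apply: (@squeeze_cvgr _ _ _ _ (fun k => 2 / 5 - harmonic k) (fun=> 2 / 5)).
- near=> k; rewrite /harmonic /= -natr1 -[(5 * k).+1%:R]natr1 !natrM.
  have k0 : 0 <= k%:R :> R by [].
  apply/andP; split; last by rewrite ler_pdivrMr; lra.
  rewrite -subr_ge0 (_ : _ - _ = (23 * k%:R + 3) / (5 * (5 * k%:R + 1) * (k%:R + 1))).
    by apply: divr_ge0; [lra|apply: mulr_ge0; lra].
  by field; apply/andP; split; apply/lt0r_neq0; lra.
- by rewrite -[X in _ --> X]subr0; apply: cvgB; [exact: cvg_cst|exact: cvg_harmonic].
- exact: cvg_cst.
Unshelve. all: by end_near.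
Qed.

Theorem mainTheorem7 (R : realType) (G : nat -> digraph)
    (hG : forall k : nat, (1 <= k)%N -> is_Gk k (G k)) :
  (forall k : nat, (1 <= k)%N -> dyn (G k) = (2 * k)%N) /\
  ((fun k : nat => (dyn (G k))%:R / (#|{: G k}|)%:R : R) @ \oo --> (2 / 5 : R)).
Proof.
have dynG k (k0 : (1 <= k)%N) := dyn_Gk k0 (hG k k0).
(* [G 0] is arbitrary, so the two sequences are only known to agree from index 1 on. *)
split=> //; apply: cvg_trans (cvg_ratio R); apply: near_eq_cvg.
near=> k; have k0 : (1 <= k)%N by near: k; exists 1%N.
by rewrite dynG // (card_Gk (hG k k0)).
Unshelve. all: by end_near.
Qed.
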